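(* Let $\mathcal{E}$ be an equation $a_1x_1+a_2x_2+\cdots+a_nx_n=0$ with nonzero integer coefficients, and suppose there is a set $I\subseteq\{1,\dots,n\}$ with $\sum_{i\in I}a_i=0$ and an index $q\in I$ such that $a_q$ divides $s=\sum_{i\notin I}a_i$. Put $m=|s/a_q|$. Then $$R_2(\mathcal{E})\le m^2+3m+1.$$
   Context: For a positive integer $N$ let $[N]=\{1,\dots,N\}$. For a linear homogeneous equation $\mathcal{E}$ with integer coefficients and a positive integer $c$, the Rado number $R_c(\mathcal{E})$ is the least positive integer $N$ such that every $c$-coloring of $[N]$ contains a monochromatic solution to $\mathcal{E}$, i.e. a solution whose variables all take values in $[N]$ (not necessarily distinct) having the same color. If no such $N$ exists, $R_c(\mathcal{E})=\infty$. *)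

(* Defs.v *)
From HB Require Import structures.
From mathcomp Require Import all_boot all_order all_algebra.
From mathcomp Require Import boolp constructive_ereal.

Set Implicit Arguments.
Unset Strict Implicit.
Unset Printing Implicit Defensive.

Import Order.TTheory GRing.Theory Num.Theory.
Local Open Scope ring_scope.

(* The equation a_1 x_1 + ... + a_n x_n = 0 is given by its coefficients
   a : 'I_n -> int.  The type 'I_N encodes [N] = {1, ..., N}: the element j
   stands for the integer j + 1. *)

Definition solution (n : nat) (a : 'I_n -> int) (N : nat)
    (x : {ffun 'I_n -> 'I_N}) : bool :=
  \sum_(i < n) a i * (x i).+1%:Z == 0.

Definition monochromatic (n c N : nat) (chi : {ffun 'I_N -> 'I_c})
    (x : {ffun 'I_n -> 'I_N}) : bool :=
  [forall i, forall j, chi (x i) == chi (x j)].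

Definition rado_property (c n : nat) (a : 'I_n -> int) (N : nat) : bool :=
  [forall chi : {ffun 'I_N -> 'I_c},
    [exists x : {ffun 'I_n -> 'I_N}, solution a x && monochromatic chi x]].

Definition rado_number (c n : nat) (a : 'I_n -> int) : \bar int :=
  match pselect (exists N : nat, (0 < N)%N && rado_property c a N) with
  | left exN => (ex_minn exN)%:Z%:E
  | right _ => +oo%E
  end.

(* Main.v *)
Require Import Defs.
From HB Require Import structures.
From mathcomp Require Import all_boot all_order all_algebra.
From mathcomp Require Import boolp constructive_ereal.
From mathcomp Require Import zify ring.

(** Giving the variables outside [I] the value [y], those of [I] other than
    [x_q] the value [z] and [x_q] the value [w] turns the equation into
    [a_q * (w - z) + s * y = 0], so it suffices to find a monochromatic solution
    of [z = x + m y] in [1, m^2 + 3m + 1].  If there were none, the colors of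
    1, m + 1, (m + 1)^2, m + 2 and m^2 + 3m + 1 would be forced in
    turn, until 1, (m + 1)^2 and m^2 + 3m + 1 have the same color. *)

Set Implicit Arguments.
Unset Strict Implicit.
Unset Printing Implicit Defensive.

Import Order.TTheory GRing.Theory Num.Theory.
Local Open Scope ring_scope.

(** The bound on [y] is separate because for [m = 0] it does not follow from the bound on
    [x + m * y]. *)
Lemma two_coloring_sol (m : nat) (P : nat -> bool) :
  exists x y : nat, [/\ (0 < x)%N, (0 < y <= m ^ 2 + 3 * m + 1)%N,
    (x + m * y <= m ^ 2 + 3 * m + 1)%N, P x = P y & P (x + m * y)%N = P x].
Proof.
apply: contrapT => noSol.
have sol x y z : (0 < x)%N -> (0 < y <= m ^ 2 + 3 * m + 1)%N ->
    z = (x + m * y)%N -> (z <= m ^ 2 + 3 * m + 1)%N -> P x = P y -> P z <> P x.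
  by move=> x0 y0 -> le_z Pxy Pzx; apply: noSol; exists x, y.
have s1 : P (m + 1)%N <> P 1%N by apply: (sol 1 1)%N => //; nia.
(* For [m = 0] the points [m + 1] and [1] coincide, against [s1]. Positivity puts [m + 2] within the
   bound for [s3] and [s4]. *)
have m_gt0 : (0 < m)%N by case: (posnP m) s1 => // ->.
have s2 : P ((m + 1) ^ 2)%N <> P (m + 1)%N.
  by apply: (sol (m + 1) (m + 1))%N => //; nia.
have s3 : P 1%N = P (m + 2)%N -> P ((m + 1) ^ 2)%N <> P 1%N by apply: sol; nia.
have s4 : P (m + 1)%N = P (m + 2)%N -> P (m ^ 2 + 3 * m + 1)%N <> P (m + 1)%N.
  by apply: sol; nia.
have s5 : P ((m + 1) ^ 2)%N = P 1%N ->
    P (m ^ 2 + 3 * m + 1)%N <> P ((m + 1) ^ 2)%N by apply: sol; nia.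
move: s1 s2 s3 s4 s5.
by case: (P 1%N); case: (P (m + 1)%N); case: (P ((m + 1) ^ 2)%N);
   case: (P (m + 2)%N); case: (P (m ^ 2 + 3 * m + 1)%N); intuition.
Qed.

Lemma rado_number_le (c n : nat) (a : 'I_n -> int) (N : nat) :
  (0 < N)%N -> rado_property c a N -> (rado_number c a <= N%:Z%:E)%E.
Proof.
move=> N0 RN; rewrite /rado_number; case: pselect => [exN|[]]; last first.
  by exists N; rewrite N0.
by case: ex_minnP => k _; rewrite lee_fin; apply; rewrite N0.
Qed.

(** As the coefficients over [I] cancel, those other than [a q] sum to [- a q], whence the factor
    [w - z]. *)
Lemma sum_three_values (n : nat) (a : 'I_n -> int) (I : {set 'I_n}) (q : 'I_n)
    (f : 'I_n -> int) (w y z : int) :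
  q \in I -> \sum_(i in I) a i = 0 ->
  f q = w -> (forall i, i \in I -> i != q -> f i = z) ->
  (forall i, i \notin I -> f i = y) ->
  \sum_i a i * f i = a q * (w - z) + (\sum_(i | i \notin I) a i) * y.
Proof.
move=> qI sumI fq fI fIC.
rewrite (bigID (mem I)) /= (bigD1 q) //= fq.
rewrite (eq_bigr (fun i => a i * z)); last by move=> i /andP[iI iq]; rewrite fI.
rewrite -mulr_suml.
rewrite [X in _ + X = _](eq_bigr (fun i => a i * y)); last first.
  by move=> i iI; rewrite fIC.
rewrite -mulr_suml; congr (_ + _).
move: sumI; rewrite (bigD1 q) //= => /eqP; rewrite addrC addr_eq0 => /eqP ->.
by ring.
Qed.

Theorem theorem4p7 (n : nat) (a : 'I_n -> int) (I : {set 'I_n}) (q : 'I_n)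
    (a_neq0 : forall i, a i != 0)
    (sumI : \sum_(i in I) a i = 0)
    (qI : q \in I)
    (s : int) (s_def : s = \sum_(i | i \notin I) a i)
    (dvd_s : (a q %| s)%Z)
    (m : int) (m_def : m = `|(s %/ a q)%Z|) :
  (rado_number 2 a <= (m ^+ 2 + 3 * m + 1)%:E)%E.
Proof.
set t := (s %/ a q)%Z in m_def.
have s_t : s = t * a q by rewrite divzK.
pose k := `|t|%N.
have -> : m ^+ 2 + 3 * m + 1 = (k ^ 2 + 3 * k).+1%:Z.
  by have -> : m = k%:Z by []; lia.
apply: rado_number_le => //; apply/forallP => chi.
have [x [y [x0 y_bd lez Pxy Pzx]]] :=
  (* The integer [j] is encoded by the ordinal [j.-1]; testing for one of the two colors makes the
     coloring Boolean. *)
  two_coloring_sol k (fun j => chi (inord j.-1) == ord0).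
have chi_inj (c d : 'I_2) : (c == ord0) = (d == ord0) -> c = d.
  move: c d => [[|[|//]] ?] [[|[|//]] ?] //= _; exact: val_inj.
move/chi_inj: Pxy => Pxy; move/chi_inj: Pzx => Pzx.
set z := (x + k * y)%N in lez Pzx.
(* Since [z - x = k * y] with [k] the absolute value of [t], the sign of [t] decides which of [x]
   and [z] goes to the variable of index [q]. *)
pose w1 := if 0 <= t then x else z; pose z1 := if 0 <= t then z else x.
have eq_tyw : w1%:Z - z1%:Z + t * y%:Z = 0.
  rewrite /w1 /z1 /z /k; case: (lerP 0 t) => t0; rewrite PoszD PoszM.
    by rewrite (gez0_abs t0); ring.
  by rewrite (ltz0_abs t0); ring.
pose v i := if i \in I then (if i == q then w1 else z1) else y.
(* These bounds keep [inord] from falling back on its default value. *)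
have vN i : (0 < v i <= (k ^ 2 + 3 * k).+1)%N.
  by rewrite /v /w1 /z1; do !case: ifP => _; rewrite /z in lez *; lia.
have chiv i : chi (inord (v i).-1) = chi (inord x.-1).
  by rewrite /v /w1 /z1; do !case: ifP => _.
apply/existsP; exists [ffun i => inord (v i).-1]; apply/andP; split; last first.
  by apply/forallP => i; apply/forallP => j; rewrite !ffunE !chiv.
rewrite /solution (@sum_three_values _ _ I q _ w1 y z1) //.
- by rewrite -s_def s_t -mulrA mulrCA -mulrDr eq_tyw mulr0.
all: have vE i : ([ffun i => inord (v i).-1] i : 'I_(k ^ 2 + 3 * k).+1).+1 = v i
  by case/andP: (vN i) => v0 vle; rewrite ffunE inordK prednK.
- by rewrite vE /v qI eqxx.
- by move=> i iI iq; rewrite vE /v iI (negbTE iq).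
- by move=> i iI; rewrite vE /v (negbTE iI).
Qed.
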